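(* For every integer $n$ of the form $n=12m-1$ with $m\ge 1$ an integer, $T_n(n^2)\ge 3n+4$; that is, there is a set of $n^2$ points in the plane for which at least $3n+4$ distinct lines each pass through at least $n$ of the points.
   Context: All points and lines are in the real plane $\mathbf{R}^2$. For a finite set $S$ of points in the plane, $T_k(S)$ denotes the number of lines meeting $S$ in at least $k$ points, and $T_k(N)$ denotes the maximum of $T_k(S)$ over all sets $S$ of $N$ points in the plane. *)

(* Defs.v *)
From mathcomp Require Import all_boot all_order all_algebra finmap.
From mathcomp Require Import all_classical all_reals.
From mathcomp Require Import ring lra.

Set Implicit Arguments.
Unset Strict Implicit.
Unset Printing Implicit Defensive.

Import Order.TTheory GRing.Theory Num.Theory.

Local Open Scope fset_scope.
Local Open Scope card_scope.
Local Open Scope classical_set_scope.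
Local Open Scope ring_scope.

Definition is_line (R : realType) (l : set (R * R)) : Prop :=
  exists a b c : R,
    (a != 0) || (b != 0) /\ l = [set p | a * p.1 + b * p.2 = c].

Definition points_on (R : realType) (S : {fset R * R}) (l : set (R * R)) :
    {fset R * R} :=
  [fset p in S | p \in l].

Definition rich_lines (R : realType) (k : nat) (S : {fset R * R}) :
    set (set (R * R)) :=
  [set l | is_line l /\ (k <= #|` points_on S l|)%N].

(* T_k(S). The value 0 that fset_set gives on an infinite set only matters
   for k <= 1: see finite_rich_lines. *)
Definition T_set (R : realType) (k : nat) (S : {fset R * R}) : nat :=
  #|` fset_set (rich_lines k S)|.

Definition T_values (R : realType) (k N : nat) : set nat :=
  [set t | exists S : {fset R * R}, #|` S| = N /\ T_set k S = t].

(* T_k(N). The default value 0 of xget is never used for k >= 2: see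
   T_max_is_maximum. *)
Definition T_max (R : realType) (k N : nat) : nat :=
  xget 0%N [set t | T_values R k N t /\ ubound (T_values R k N) t].

Lemma line_subset (R : realType) (l1 l2 : set (R * R)) (p q : R * R) :
  is_line l1 -> is_line l2 -> p != q ->
  l1 p -> l1 q -> l2 p -> l2 q -> l1 `<=` l2.
Proof.
move=> [a [b [c [ab0 ->]]]] [a' [b' [c' [_ ->]]]] pq /= p1 q1 p2 q2 r /= r1.
have crs : (r.1 - p.1) * (q.2 - p.2) = (r.2 - p.2) * (q.1 - p.1).
  case/orP: ab0 => [a0|b0]; [apply: (mulfI a0)|apply: (mulfI b0)].
    have e1 : a * (r.1 - p.1) = - b * (r.2 - p.2) by lra.
    have e2 : a * (q.1 - p.1) = - b * (q.2 - p.2) by lra.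
    by rewrite mulrA e1 [RHS]mulrCA e2; ring.
  have e1 : b * (r.2 - p.2) = - a * (r.1 - p.1) by lra.
  have e2 : b * (q.2 - p.2) = - a * (q.1 - p.1) by lra.
  by rewrite mulrCA e2 [RHS]mulrA e1; ring.
have d2 : a' * (q.1 - p.1) + b' * (q.2 - p.2) = 0 by lra.
suff : a' * (r.1 - p.1) + b' * (r.2 - p.2) = 0 by lra.
have [e1|d10] := eqVneq (q.1 - p.1) 0.
  have d20 : q.2 - p.2 != 0.
    apply: contra pq => /eqP e2; apply/eqP; rewrite [p]surjective_pairing.
    by rewrite [q]surjective_pairing; congr pair; lra.
  apply: (mulfI d20); rewrite mulr0 mulrDr.
  rewrite [_ * (a' * _)](_ : _ = a' * ((r.1 - p.1) * (q.2 - p.2))); last ring.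
  rewrite crs; transitivity
    ((r.2 - p.2) * (a' * (q.1 - p.1) + b' * (q.2 - p.2))); first by ring.
  by rewrite d2 mulr0.
apply: (mulfI d10); rewrite mulr0 mulrDr.
rewrite [_ * (b' * _)](_ : _ = b' * ((r.2 - p.2) * (q.1 - p.1))); last ring.
rewrite -crs; transitivity
  ((r.1 - p.1) * (a' * (q.1 - p.1) + b' * (q.2 - p.2))); first by ring.
by rewrite d2 mulr0.
Qed.

Lemma points_on_inj (R : realType) (k : nat) (S : {fset R * R}) :
  (1 < k)%N -> {in rich_lines k S &, injective (points_on S)}.
Proof.
move=> k1 l1 l2; rewrite !inE => -[L1 c1] [L2 _] e.
have [s0 [u [s us]]] : exists p q, p != q /\
    (p \in points_on S l1) && (q \in points_on S l1).
  have c2 : (1 < #|` points_on S l1|)%N by exact: leq_trans c1.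
  have /fset0Pn[p pS] : points_on S l1 != fset0.
    by rewrite -cardfs_gt0 ltnW.
  have : (0 < #|` (points_on S l1 `\ p)%fset|)%N.
    by move: c2; rewrite (cardfsD1 p) pS.
  rewrite cardfs_gt0 => /fset0Pn[q]; rewrite in_fsetD1 => /andP[qp qS].
  by exists p, q; rewrite eq_sym qp pS qS.
have /andP[] := us; rewrite e => p2 q2.
have /andP[p1 q1] := us.
move: p1 q1 p2 q2; rewrite !inE /=.
move=> /andP[_ /set_mem p1] /andP[_ /set_mem q1].
move=> /andP[_ /set_mem p2] /andP[_ /set_mem q2].
by apply/seteqP; split;
  [exact: line_subset L1 L2 s p1 q1 p2 q2|exact: line_subset L2 L1 s p2 q2 p1 q1].
Qed.

Lemma rich_lines_card_le (R : realType) (k : nat) (S : {fset R * R}) :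
  (1 < k)%N -> rich_lines k S #<= [set` fpowerset S].
Proof.
move=> k1; rewrite -(card_le_eql (inj_card_eq (@points_on_inj R k S k1))).
apply: subset_card_le => _ [l _ <-] /=; rewrite fpowersetE.
by apply/fsubsetP => p; rewrite !inE /= => /andP[].
Qed.

Lemma finite_rich_lines (R : realType) (k : nat) (S : {fset R * R}) :
  (1 < k)%N -> finite_set (rich_lines k S).
Proof.
by move=> /(@rich_lines_card_le R k S)/card_le_finite; apply; exact: finite_fset.
Qed.

Lemma T_set_le (R : realType) (k : nat) (S : {fset R * R}) :
  (1 < k)%N -> (T_set k S <= 2 ^ #|` S|)%N.
Proof.
move=> k1; apply: geq_card_fset_set; rewrite -card_fpowerset.
apply: card_le_trans (rich_lines_card_le S k1) _.
have /card_eq_fsetP e := erefl #|` fpowerset S|.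
by rewrite (card_le_eql e) card_le_II.
Qed.

Lemma T_max_is_maximum (R : realType) (k N : nat) :
  (1 < k)%N ->
  T_values R k N (T_max R k N) /\ ubound (T_values R k N) (T_max R k N).
Proof.
move=> k1.
have T0 : exists t, `[< T_values R k N t >].
  exists (T_set k [fset (i%:R : R, 0 : R) | i in iota 0 N]); apply/asboolP.
  eexists; split; last reflexivity.
  rewrite card_in_imfset /=; last by move=> i j _ _ /= [] /eqP; rewrite eqr_nat => /eqP.
  by rewrite undup_id ?iota_uniq ?size_iota.
have Tb t : `[< T_values R k N t >] -> (t <= 2 ^ N)%N.
  by move=> /asboolP[S [<- <-]]; exact: T_set_le.
have [t /asboolP tT tmax] := ex_maxnP T0 Tb.
rewrite /T_max; apply: (@xgetPex _ 0%N
  [set t | T_values R k N t /\ ubound (T_values R k N) t]).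
by exists t; split=> // u Tu; rewrite leEnat; exact/tmax/asboolP.
Qed.

(* Main.v *)
Require Import Defs.
From mathcomp Require Import all_boot all_order all_algebra finmap.
From mathcomp Require Import all_classical all_reals.
From mathcomp Require Import trigo.
From mathcomp Require Import zify ring lra.

Set Implicit Arguments.
Unset Strict Implicit.
Unset Printing Implicit Defensive.

Import Order.TTheory GRing.Theory Num.Theory.

Local Open Scope classical_set_scope.
Local Open Scope ring_scope.

(** Put N = n + 1 = 12 m and take two concentric regular N-gons, one rotated
by pi / N against the other, so that all 2N sides are tangent to two circles
and together have 2N equally spaced normal directions; the tangent of index i
has inradius [inradius i], which depends on the parity of i.  The two polygons
share their N symmetry axes.  The rich lines are the 2N sides, the N axes and
the line at infinity: 3 N + 1 = 3 n + 4 lines.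

The sides h + d and h - d of one polygon meet on the axis h, at the projective
point (cos (h pi / N) : sin (h pi / N) : height h d), where height h d is
cos (d pi / N) divided by their inradius.  Every side meets the N - 1 axes other
than the one through its point of contact in such a point, and as N is even the
points with d = N / 2 put a point at infinity on every axis.

For a generic ratio of the radii the axes would carry N - 1 such points each,
and the total N (N - 1) would exceed n ^ 2.  The ratio is chosen so that two
rings of intersection points of one polygon coincide with two rings of the
other, which is the trigonometric identity
cos t / cos (pi / 3) = cos (pi / 2 - 2 t) / cos (pi / 2 - t) for t = pi / N.
Since pi / 3 and pi / 2 have to be multiples of pi / N of the right parity,
12 has to divide N.  Each axis meets exactly one of the two common rings and loses
two points ([few_heights]), so it has at most N - 3 of them; it is filled up to
N - 2 points, and the common centre is added as one more.  Then every axis has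
N - 1 = n points, and the total is 1 + N (N - 2) = (N - 1) ^ 2 = n ^ 2.

A projective map that sends none of these points to infinity, found in
[exists_chart_direction], moves the configuration into the affine plane.  It is
chosen to fix the centre and the axes; sides and line at infinity do not pass
through the centre, so they become lines A x + B y = 1, which are determined by
their pole (A, B) ([polar_line_inj]).  The poles of the sides are the points
(cos, sin) / inradius, all shifted by the same vector w, and the line at
infinity has pole w: this makes it easy to see that the lines are distinct. *)

(** * Finite sequences and rich lines *)

Lemma exists_notin (R : numDomainType) (s : seq R) : exists x, x \notin s.
Proof.
have [/hasP[x _ xs]|/hasPn sub] :=
  boolP (has (fun x => x \notin s) [seq i%:R | i <- iota 0 (size s).+1]).
  by exists x.
have : (size [seq (i%:R : R) | i <- iota 0 (size s).+1] <= size s)%N.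
  apply: uniq_leq_size => [|x /sub/negPn//].
  by rewrite map_inj_uniq ?iota_uniq // => i j /eqP; rewrite eqr_nat => /eqP.
by rewrite size_map size_iota ltnn.
Qed.

Lemma exists_uniq_superset (R : numDomainType) (k : nat) (s : seq R) :
  (size s <= k)%N -> exists t, [/\ uniq t, size t = k & {subset s <= t}].
Proof.
elim: k s => [|k IH] s.
  by rewrite leqn0 => /nilP ->; exists [::].
case: s => [_|x s /= sk].
  have [t [ut st _]] := IH [::] isT.
  by have [x xt] := exists_notin t; exists (x :: t); rewrite /= xt ut st.
have [t [ut st sub]] := IH s sk.
have [xt|xt] := boolP (x \in t).
  have [y yt] := exists_notin t; exists (y :: t); split; rewrite /= ?yt ?st //.
  move=> z; rewrite !inE => /orP[/eqP->|/sub->]; by rewrite ?xt orbT.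
exists (x :: t); split; rewrite /= ?xt ?st // => z.
by rewrite !inE => /orP[->|/sub->]; rewrite ?orbT.
Qed.

(** Two values taken twice make the image of [s] two smaller: the arguments
[a] and [b] can be dropped because [a'] and [b'] stay. *)
Lemma image_two_repeats (T : Type) (f : nat -> T) (s : seq nat)
    (a b a' b' : nat) :
  uniq s -> a \in s -> b \in s -> a' \in s -> b' \in s -> a != b ->
  a' \notin [:: a; b] -> b' \notin [:: a; b] -> f a = f a' -> f b = f b' ->
  exists t : seq nat, size t = (size s - 2)%N /\
    forall x, x \in s -> exists2 y, y \in t & f y = f x.
Proof.
move=> us as_ bs a's b's ab; rewrite !inE !negb_or.
move=> /andP[a'a a'b] /andP[b'a b'b] fa fb; exists (rem b (rem a s)); split.
  rewrite size_rem; first by rewrite size_rem // -subn1 -subn1 -subnDA.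
  by rewrite mem_rem_uniq // inE /= eq_sym ab.
have mem x : (x \in rem b (rem a s)) = [&& x != b, x != a & x \in s].
  by rewrite mem_rem_uniq ?rem_uniq // inE mem_rem_uniq // inE.
move=> x xs; have [->|xb] := eqVneq x b.
  by exists b'; rewrite ?mem ?b'a ?b'b.
have [->|xa] := eqVneq x a; first by exists a'; rewrite ?mem ?a'a ?a'b.
by exists x; rewrite ?mem ?xa ?xb.
Qed.

Lemma leq_card_points_on (R : realType) (S : {fset R * R}) (l : set (R * R))
    (s : seq nat) (f : nat -> R * R) :
  uniq s -> {in s &, injective f} ->
  (forall i, i \in s -> f i \in S /\ l (f i)) ->
  (size s <= #|` points_on S l|)%N.
Proof.
move=> us fi fS; rewrite -(size_map f).
apply: uniq_leq_size; first by rewrite map_inj_in_uniq.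
move=> _ /mapP[i /fS[iS il] ->]; rewrite !inE /= iS /=; exact: mem_set.
Qed.

Lemma rich_lines_leq_T_max (R : realType) (k N : nat) (S : {fset R * R})
    (L : {fset set (R * R)}) :
  (1 < k)%N -> #|` S| = N ->
  (forall l, l \in L -> is_line l /\ (k <= #|` points_on S l|)%N) ->
  (#|` L| <= T_max R k N)%N.
Proof.
move=> k1 SN SL; have [_ ub] := @T_max_is_maximum R k N k1.
apply: (@leq_trans (T_set k S)); last first.
  by have := ub (T_set k S); rewrite leEnat; apply; exists S.
apply: uniq_leq_size => // l lL.
by rewrite in_fset_set; [apply/mem_set/SL|exact: finite_rich_lines].
Qed.

(** The line with pole [w] with respect to the unit circle; it is empty for
[w = (0, 0)]. *)
Definition polar_line (R : realType) (w : R * R) : set (R * R) :=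
  [set p | w.1 * p.1 + w.2 * p.2 = 1].

(** If the first coordinate [x] of a pole is nonzero, the line meets the first
axis in [(x^-1, 0)], so that it determines [x]; the same holds for the second
coordinate. *)
Lemma polar_line_inj (R : realType) : injective (@polar_line R).
Proof.
move=> [a b] [a' b'] /seteqP /= [sub sub'].
have key (x y x' y' : R) :
    (forall u v, x * u + y * v = 1 -> x' * u + y' * v = 1) ->
    (forall u v, x' * u + y' * v = 1 -> x * u + y * v = 1) -> x = x'.
  move=> h h'; have [x0|x0] := eqVneq x 0; last first.
    have := h x^-1 0; rewrite !mulr0 !addr0 divff // => /(_ erefl) e.
    by rewrite -[RHS](mulfVK x0) e mul1r.
  have [->//|x0'] := eqVneq x' 0.
  have := h' x'^-1 0; rewrite !mulr0 !addr0 divff // x0 mul0r => /(_ erefl).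
  by move=> /eqP; rewrite eq_sym oner_eq0.
congr pair.
  by apply: (key a b a' b') => u v; [exact: (sub (u, v))|exact: (sub' (u, v))].
by apply: (key b a b' a') => u v; rewrite ![_ * u + _]addrC;
  [exact: (sub (v, u))|exact: (sub' (v, u))].
Qed.

(** * Multiples of the angle pi / N *)

Section Angles.
Variables (R : realType) (N : nat).
Hypothesis N_gt0 : (0 < N)%N.

Definition angle (k : nat) : R := pi * k%:R / N%:R.
Definition cosn (k : nat) : R := cos (angle k).
Definition sinn (k : nat) : R := sin (angle k).

Let N_neq0 : N%:R != 0 :> R. Proof. by rewrite pnatr_eq0 -lt0n. Qed.

Lemma angleB i j : (j <= i)%N -> angle (i - j) = angle i - angle j.
Proof. by move=> ji; rewrite /angle natrB // mulrBr mulrBl. Qed.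

Lemma angle_half k : angle k = pi * k%:R / (2 * N)%:R *+ 2.
Proof. by rewrite /angle natrM; field. Qed.

Lemma angleN : angle N = pi.
Proof. by rewrite /angle mulfK. Qed.

Lemma angle2N : angle (2 * N) = pi *+ 2.
Proof. by rewrite /angle natrM; field. Qed.

Lemma cosn2Dsinn2 k : cosn k ^+ 2 + sinn k ^+ 2 = 1.
Proof. exact: cos2Dsin2. Qed.

Lemma sinn_gt0 k : (0 < k < N)%N -> 0 < sinn k.
Proof.
move=> /andP[k0 kN]; apply: sin_gt0_pi; have p0 := pi_gt0 R.
have N0 : 0 < N%:R :> R by rewrite ltr0n.
rewrite /angle divr_gt0 ?mulr_gt0 ?ltr0n //=.
by rewrite ltr_pdivrMr // ltr_pM2l // ltr_nat.
Qed.

Lemma cosn_sub i j : (j <= i)%N ->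
  cosn i * cosn j + sinn i * sinn j = cosn (i - j).
Proof. by move=> ji; rewrite /cosn angleB // cosB. Qed.

Lemma sinn_sub i j : (j <= i)%N ->
  sinn i * cosn j - cosn i * sinn j = sinn (i - j).
Proof. by move=> ji; rewrite /sinn angleB // sinB. Qed.

Lemma cosn_2NB k : (k <= 2 * N)%N -> cosn (2 * N - k) = cosn k.
Proof. by move=> k2; rewrite /cosn angleB // angle2N addrC cosD2pi cosN. Qed.

Lemma cosn_NB k : (k <= N)%N -> cosn (N - k) = - cosn k.
Proof. by move=> kN; rewrite /cosn angleB // angleN addrC cosDpi cosN. Qed.

Lemma cosn_double k : cosn (2 * k) = 2 * cosn k ^+ 2 - 1.
Proof.
by rewrite /cosn [angle (2 * k)](_ : _ = angle k *+ 2) ?cos_mulr2n;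
  [ring|rewrite /angle natrM; field].
Qed.

Lemma sinn_double k : sinn (2 * k) = 2 * (sinn k * cosn k).
Proof.
by rewrite /sinn [angle (2 * k)](_ : _ = angle k *+ 2) ?sin_mulr2n;
  [rewrite /cosn; ring|rewrite /angle natrM; field].
Qed.

Lemma cosn_lt1 k : (0 < k < 2 * N)%N -> cosn k < 1.
Proof.
move=> /andP[k0 k2]; rewrite /cosn angle_half cos_mulr2n cos2sin2.
have N0 : 0 < (2 * N)%:R :> R by rewrite ltr0n muln_gt0.
suff : 0 < sin (pi * k%:R / (2 * N)%:R : R) by set s := sin _; nra.
apply: sin_gt0_pi; have p0 := pi_gt0 R.
rewrite divr_gt0 ?mulr_gt0 ?ltr0n ?muln_gt0 //=.
by rewrite ltr_pdivrMr // ltr_pM2l // ltr_nat.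
Qed.

(** The [2 * N] directions of the normals of the sides are distinct. *)
Lemma vertex_inj i j : (i < 2 * N)%N -> (j < 2 * N)%N ->
  cosn i = cosn j -> sinn i = sinn j -> i = j.
Proof.
wlog ji : i j / (j <= i)%N.
  by move=> H i2 j2 ec es; case: (leqP j i) => [/H->//|/ltnW/H->].
move=> i2 _ ec es; apply/eqP; rewrite eqn_leq ji andbT -subn_eq0.
apply: contraT; rewrite -lt0n => d0.
have := @cosn_lt1 (i - j)%N; rewrite d0 -cosn_sub // ec es -!expr2 cosn2Dsinn2.
by rewrite ltxx; apply; lia.
Qed.

(** The [N] axes have distinct directions modulo sign. *)
Lemma axis_inj i j : (i < N)%N -> (j < N)%N ->
  sinn i * cosn j = cosn i * sinn j -> i = j.
Proof.
wlog ji : i j / (j <= i)%N.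
  move=> H iN jN e; case: (leqP j i) => [/H->//|/ltnW/H->//].
  by rewrite mulrC -e mulrC.
move=> iN _ e; apply/eqP; rewrite eqn_leq ji andbT -subn_eq0.
apply: contraT; rewrite -lt0n => d0.
have := @sinn_gt0 (i - j)%N; rewrite d0 -sinn_sub // e subrr ltxx; apply; lia.
Qed.

End Angles.

(** * The two polygons and their common rings *)

Section Heights.
Variables (R : realType) (m : nat).
Hypothesis m_gt0 : (0 < m)%N.
Let N := (12 * m)%N.
Let N_gt0 : (0 < N)%N. Proof. by rewrite /N; lia. Qed.
Local Notation C := (@cosn R N).
Local Notation S := (@sinn R N).

(** The two values are in the ratio cos (pi / N) : cos (pi / 3), which makes
two rings common to both polygons. *)
Definition inradius (i : nat) : R := if odd i then 1 else 2 * C 1.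
(** The intersection of the sides [h + d] and [h - d] has homogeneous
coordinates [(C h, S h, height h d)], so its distance to the centre is the
inverse of the absolute value of [height h d]. *)
Definition height (h d : nat) : R := C d / inradius (h + d).

Lemma cosn_gt0 k : (2 * k < N)%N -> 0 < C k.
Proof.
move=> kN; apply: cos_gt0_pihalf; have p0 := pi_gt0 R.
have N0 : 0 < N%:R :> R by rewrite ltr0n.
have a0 : 0 <= @angle R N k by rewrite /angle divr_ge0 ?mulr_ge0 // ltW.
rewrite (lt_le_trans _ a0) /=; last by rewrite oppr_lt0 divr_gt0.
rewrite /angle ltr_pdivrMr // -mulrA ltr_pM2l // ltr_pdivlMl //.
by rewrite -natrM ltr_nat.
Qed.

Lemma inradius_gt0 i : 0 < inradius i.
Proof.
by rewrite /inradius; case: odd => //; rewrite mulr_gt0 ?cosn_gt0 // /N; lia.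
Qed.

(** For [c] the cosine of pi / 3, the duplication formula and
cos (2 pi / 3) = - c give [(c + 1) * (2 * c - 1) = 0]. *)
Lemma cosn_third : C (4 * m) = 2^-1.
Proof.
have := cosn_double R N_gt0 (4 * m).
rewrite (_ : (2 * (4 * m)) = N - 4 * m)%N; last by rewrite /N; lia.
rewrite cosn_NB //; last by rewrite /N; lia.
have : 0 < C (4 * m) by apply: cosn_gt0; rewrite /N; lia.
set c := C _ => c0 e; have : (c + 1) * (2 * c - 1) = 0 by lra.
by move=> /eqP; rewrite mulf_eq0 => /orP[] /eqP; lra.
Qed.

Lemma cosn_quarterB k : (k <= 6 * m)%N -> C (6 * m - k) = S k.
Proof.
move=> km; rewrite /cosn angleB // -cosN opprB.
rewrite (_ : angle R N (6 * m) = pi / 2) ?cosBpihalf //.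
by rewrite /angle /N !natrM; field; rewrite pnatr_eq0 -lt0n m_gt0.
Qed.

Lemma height_opp h d : (d <= N)%N -> height h (N - d) = - height h d.
Proof.
move=> dN; rewrite /height cosn_NB // mulNr /inradius.
by rewrite (_ : odd (h + (N - d)) = odd (h + d)) // /N; move: dN; rewrite /N; lia.
Qed.

(** The first common ring, of intersection points on the axes of odd index:
both sides equal 1/2. *)
Lemma height_odd h : odd h -> height h 1 = height h (4 * m).
Proof.
move=> oh; rewrite /height /inradius cosn_third.
have -> : odd (h + 1) = false by lia.
have -> : odd (h + 4 * m) by lia.
have : 0 < C 1 by apply: cosn_gt0; rewrite /N; lia.
by move=> c0; field; rewrite gt_eqF.
Qed.

(** The second common ring, on the axes of even index.  With t = pi / N it says
sin t = sin (2 t) / (2 cos t). *)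
Lemma height_even h : ~~ odd h -> height h (6 * m - 1) = height h (6 * m - 2).
Proof.
move=> eh; rewrite /height /inradius !cosn_quarterB; [|lia|lia].
have -> : odd (h + (6 * m - 1)) by lia.
have -> : odd (h + (6 * m - 2)) = false by lia.
have : 0 < C 1 by apply: cosn_gt0; rewrite /N; lia.
by move=> c0; rewrite (sinn_double R N_gt0 1); field; rewrite gt_eqF.
Qed.

(** On the axis [h], the [N - 1] values of [d] give at most [N - 3] heights:
one of the common rings is met in two opposite points, of heights [height h d]
and [height h (N - d)].  The set is then enlarged to exactly [N - 2] heights. *)
Lemma few_heights h : exists V : seq R,
  [/\ uniq V, size V = (N - 2)%N
    & forall d, (0 < d < N)%N -> height h d \in V].
Proof.
suff [s [sz sP]] : exists s : seq nat, size s = (N - 3)%N /\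
    forall d, d \in iota 1 (N - 1) ->
      exists2 e, e \in s & height h e = height h d.
  have [] := @exists_uniq_superset R (N - 2) (map (height h) s).
    by rewrite size_map sz; lia.
  move=> V [uV sV sub]; exists V; split=> // d dN.
  have [|e es <-] := sP d; first by rewrite mem_iota; lia.
  exact/sub/map_f.
have us := iota_uniq 1 (N - 1).
rewrite (_ : (N - 3 = size (iota 1 (N - 1)) - 2)%N); last by rewrite size_iota; lia.
have [oh|eh] := boolP (odd h).
  apply: (@image_two_repeats _ _ _ 1 (N - 1) (4 * m) (N - 4 * m)) => //;
    rewrite ?mem_iota ?inE ?negb_or /N; try lia.
    exact: height_odd.
  by rewrite !height_opp ?(height_odd oh) // /N; lia.
apply: (@image_two_repeats _ _ _ (6 * m - 1) (N - (6 * m - 1)) (6 * m - 2)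
  (N - (6 * m - 2))) => //;
  rewrite ?mem_iota ?inE ?negb_or /N; try lia.
  exact: height_even.
by rewrite !height_opp ?(height_even eh) // /N; lia.
Qed.

Lemma height0 h : height h (6 * m) = 0.
Proof.
rewrite /height -[X in C X]subn0 cosn_quarterB // /sinn /angle.
by rewrite mulr0 mul0r sin0 mul0r.
Qed.

(** A point [(C h, S h, v)] lies on the side [i] if and only if
[C i * C h + S i * S h = inradius i * v].  This [v] is one of the heights of the
axis [h] as soon as [i] differs from [h] modulo [N]; the sign and the size of
[i - h] are adjusted by the symmetries of the cosine, which keep the parity of
[h + d]. *)
Lemma tangent_height i h : (i < 2 * N)%N -> (h < N)%N -> h != i ->
    (h + N)%N != i ->
  exists2 d, (0 < d < N)%N &
    height h d = (C i * C h + S i * S h) / inradius i.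
Proof.
move=> i2 hN hi hNi.
have [d [dN pd <-]] : exists d, [/\ (0 < d < N)%N, odd (h + d) = odd i
    & C d = C i * C h + S i * S h].
  case: (leqP h i) => [le_hi|/ltnW le_ih]; last first.
    exists (h - i)%N; rewrite -cosn_sub // [C i * _]mulrC [S i * _]mulrC.
    by split=> //; lia.
  rewrite cosn_sub //; case: (ltnP (i - h) N) => dN.
    by exists (i - h)%N; split=> //; lia.
  by exists (2 * N - (i - h))%N; rewrite cosn_2NB //; [split=> //; lia|lia].
by exists d; rewrite // /height /inradius pd.
Qed.

End Heights.

(** * The affine configuration *)

Section Configuration.
Variables (R : realType) (m : nat).
Hypothesis m_gt0 : (0 < m)%N.
Let N := (12 * m)%N.
Let N_gt0 : (0 < N)%N. Proof. by rewrite /N; lia. Qed.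
Local Notation C := (@cosn R N).
Local Notation S := (@sinn R N).

Variable V : nat -> seq R.
Hypothesis V_uniq : forall h, uniq (V h).
Hypothesis V_size : forall h, size (V h) = (N - 2)%N.
Hypothesis heightV : forall h d, (0 < d < N)%N -> height R m h d \in V h.

Variable w : R * R.
Hypothesis w_neq0 : forall h v, (h < N)%N -> v \in V h ->
  w.1 * C h + w.2 * S h + v != 0.

(** The affine image of the projective point [(C h, S h, v)] when the line
[w.1 * x + w.2 * y + z = 0] is sent to infinity.  The centre [(0, 0, 1)] goes to
[(0, 0)]. *)
Definition chart (h : nat) (v : R) : R * R :=
  (C h / (w.1 * C h + w.2 * S h + v), S h / (w.1 * C h + w.2 * S h + v)).

Definition axis (h : nat) : set (R * R) :=
  [set p | S h * p.1 + (- C h) * p.2 = 0].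

(** The image of the side [i], of equation [C i * x + S i * y = inradius i * z],
is [polar_line (pole i)]; that of the line at infinity [z = 0] is
[polar_line w]. *)
Definition pole (i : nat) : R * R :=
  (C i / inradius R m i + w.1, S i / inradius R m i + w.2).

Definition config_points : seq (R * R) :=
  (0, 0) :: [seq chart h v | h <- iota 0 N, v <- V h].

Definition config_lines : seq (set (R * R)) :=
  [seq axis h | h <- iota 0 N] ++
  [seq polar_line u | u <- rcons [seq pole i | i <- iota 0 (2 * N)] w].

Lemma chart_neq0 h v : (h < N)%N -> v \in V h -> chart h v != (0, 0).
Proof.
move=> hN vV; have nz := w_neq0 hN vV; apply/eqP => -[/eqP e1 /eqP e2].
move: e1 e2; rewrite !mulf_eq0 !invr_eq0 (negbTE nz) !orbF => /eqP c0 /eqP s0.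
have := cosn2Dsinn2 R N h; rewrite c0 s0 !expr0n addr0 => /eqP.
by rewrite eq_sym oner_eq0.
Qed.

Lemma chart_inj h v h' v' : (h < N)%N -> v \in V h -> (h' < N)%N ->
  v' \in V h' -> chart h v = chart h' v' -> h = h' /\ v = v'.
Proof.
move=> hN vV hN' vV'; have nz := w_neq0 hN vV; have nz' := w_neq0 hN' vV'.
move=> e; have hh : h = h'.
  apply: (@axis_inj R N) => //; case: e => e1 e2.
  apply: (mulfI (invr_neq0 nz)); apply: (mulfI (invr_neq0 nz')).
  move: e1 e2; set a := _^-1; set b := _^-1 => e1 e2.
  transitivity ((S h * a) * (C h' * b)); first ring.
  by rewrite e2 -e1; ring.
subst h'; split=> //; case: e => e1 e2.
move: nz nz' e1 e2; set a := _ + v; set b := _ + v' => nz nz' e1 e2.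
suff : a^-1 = b^-1 by move/invr_inj; rewrite /a /b => /addrI.
transitivity (a^-1 * (C h ^+ 2 + S h ^+ 2)); first by rewrite cosn2Dsinn2 mulr1.
rewrite mulrDr !expr2 ![_^-1 * (_ * _)]mulrA ![_^-1 * _]mulrC e1 e2.
by rewrite -[RHS]mulr1 -(cosn2Dsinn2 R N h); ring.
Qed.

Lemma config_points_uniq : uniq config_points.
Proof.
rewrite /=; apply/andP; split.
  apply/negP => /allpairsPdep[h [v [hN vV e]]]; have := @chart_neq0 h v.
  by rewrite -e eqxx; move: hN; rewrite mem_iota add0n => /= hN /(_ hN vV).
apply: allpairs_uniq_dep; [exact: iota_uniq|by move=> h _; exact: V_uniq|].
move=> _ _ /allpairsPdep[h [v [hN vV ->]]]
  /allpairsPdep[h' [v' [hN' vV' ->]]] /=.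
move: hN hN'; rewrite !mem_iota !add0n /= => hN hN' /chart_inj.
by move=> /(_ hN vV hN' vV') [-> ->].
Qed.

Lemma size_config_points : size config_points = ((N - 1) ^ 2)%N.
Proof.
rewrite /= size_allpairs_dep (eq_map (V_size : _ =1 fun=> (N - 2)%N)).
have -> k a : sumn [seq (N - 2)%N | _ <- iota a k] = (k * (N - 2))%N.
  by elim: k a => //= k IH a; rewrite IH mulSn.
by rewrite /N; case: m m_gt0 => [//|k _]; rewrite -mulnn; nia.
Qed.

(** The squared norm of [(C i, S i) / inradius i] gives the inradius back, and
then the direction. *)
Lemma pole_inj : {in iota 0 (2 * N) &, injective pole}.
Proof.
move=> i j; rewrite !mem_iota !add0n /= => iN jN [/addIr ec /addIr es].
have ri := inradius_gt0 R m_gt0 i; have rj := inradius_gt0 R m_gt0 j.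
have er : inradius R m i = inradius R m j.
  have : (inradius R m i)^-1 ^+ 2 = (inradius R m j)^-1 ^+ 2.
    rewrite -[LHS]mulr1 -[RHS]mulr1 -{1}(cosn2Dsinn2 R N i).
    rewrite -(cosn2Dsinn2 R N j) !mulrDr -!exprMn ![_^-1 * _]mulrC.
    by rewrite ec es.
  by move/eqP; rewrite eqrXn2 ?invr_ge0 1?ltW // => /eqP/invr_inj.
move: ec es; rewrite er.
by move=> /(mulIf (invr_neq0 (lt0r_neq0 rj))) ec
  /(mulIf (invr_neq0 (lt0r_neq0 rj))); exact: vertex_inj.
Qed.

Lemma pole_neq i : pole i != w.
Proof.
apply/eqP => e; have r0 := inradius_gt0 R m_gt0 i.
have := cosn2Dsinn2 R N i; move: e; rewrite /pole.
case: w => a b [] /=.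
rewrite -[RHS]add0r => /addIr /eqP e1; rewrite -[RHS]add0r => /addIr /eqP e2.
move: e1 e2; rewrite !mulf_eq0 invr_eq0 (gt_eqF r0) !orbF => /eqP -> /eqP ->.
by rewrite !expr0n addr0 => /eqP; rewrite eq_sym oner_eq0.
Qed.

Lemma axis_set_inj : {in iota 0 N &, injective axis}.
Proof.
move=> i j; rewrite !mem_iota !add0n /= => iN jN e.
apply: (@axis_inj R N) => //.
have : axis i (C i, S i) by rewrite /axis /=; ring.
by rewrite e /axis /= => h; lra.
Qed.

(** The axes pass through the centre [(0, 0)], and no [polar_line] does. *)
Lemma config_lines_uniq : uniq config_lines.
Proof.
rewrite cat_uniq map_inj_in_uniq ?iota_uniq; last exact: axis_set_inj.
rewrite map_inj_uniq ?rcons_uniq; last exact: polar_line_inj.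
rewrite map_inj_in_uniq ?iota_uniq; last exact: pole_inj.
rewrite /= andbT; apply/andP; split; last first.
  by apply/negP => /mapP[i _ /eqP]; rewrite eq_sym (negbTE (pole_neq i)).
apply/hasPn => _ /mapP[u _ ->]; apply/negP => /mapP[h _ e].
have : axis h (0, 0) by rewrite /axis /= !mulr0 addr0.
by rewrite -e /polar_line /= !mulr0 addr0 => /eqP; rewrite eq_sym oner_eq0.
Qed.

Lemma size_config_lines : size config_lines = (3 * N + 1)%N.
Proof.
by rewrite size_cat !size_map size_rcons size_map !size_iota; lia.
Qed.

Lemma mem_chart h v : (h < N)%N -> v \in V h -> chart h v \in config_points.
Proof.
move=> hN vV; rewrite inE; apply/orP; right.
by apply/allpairsPdep; exists h, v; rewrite mem_iota add0n hN vV.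
Qed.

Lemma chart_on_axis h v : axis h (chart h v).
Proof. by rewrite /axis /chart /=; ring. Qed.

Lemma chart_on_polar h v u : (h < N)%N -> v \in V h ->
  u.1 * C h + u.2 * S h = v -> polar_line (u.1 + w.1, u.2 + w.2) (chart h v).
Proof.
move=> hN vV e; have nz := w_neq0 hN vV; rewrite /polar_line /chart /=.
by apply: (mulfI nz); rewrite -e in nz *; field.
Qed.

Lemma is_line_polar (u p : R * R) : polar_line u p -> is_line (polar_line u).
Proof.
move=> up; exists u.1, u.2, 1; split=> //; apply: contraT.
rewrite negb_or !negbK => /andP[/eqP e1 /eqP e2].
move: up; rewrite /polar_line /= e1 e2 !mul0r addr0 => /eqP.
by rewrite eq_sym oner_eq0.
Qed.

Lemma is_line_axis h : is_line (axis h).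
Proof.
exists (S h), (- C h), 0; split=> //; apply: contraT.
rewrite negb_or !negbK oppr_eq0 => /andP[/eqP e1 /eqP e2].
have := cosn2Dsinn2 R N h; rewrite e1 e2 !expr0n addr0 => /eqP.
by rewrite eq_sym oner_eq0.
Qed.

Let points := [fset p in config_points]%fset.

(** The centre, which is the value of [f] at 0, and the [N - 2] points of the
axis. *)
Lemma config_axis_rich h : (h < N)%N ->
  (N - 1 <= #|` points_on points (axis h)|)%N.
Proof.
move=> hN; have h0 := chart_neq0 hN.
pose f k : R * R := if k is k'.+1 then chart h (nth 0 (V h) k') else (0, 0).
have fV k : (k < N - 2)%N -> nth 0 (V h) k \in V h.
  by move=> kN; rewrite mem_nth // V_size.
rewrite -(size_iota 0 (N - 1)); apply: (leq_card_points_on (f := f)).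
- exact: iota_uniq.
- move=> [|i] [|j] //; rewrite !mem_iota !add0n /=.
  + by move=> _ jN e; have := h0 _ (fV j ltac:(lia)); rewrite -e eqxx.
  + by move=> iN _ e; have := h0 _ (fV i ltac:(lia)); rewrite e eqxx.
  + move=> iN jN /chart_inj[]; rewrite ?fV //; try lia.
    by move=> _ /eqP; rewrite nth_uniq ?V_size //; [move=> /eqP ->|lia|lia].
- move=> [|i]; rewrite mem_iota add0n /= => iN; rewrite !inE.
    by rewrite eqxx /axis /= !mulr0 addr0.
  split; last exact: chart_on_axis.
  by rewrite -in_cons; apply: mem_chart => //; apply: fV; lia.
Qed.

(** A line through one point of the configuration on each axis with index in
[s]; the sides and the line at infinity are the cases [u = pole i - w] and
[u = (0, 0)]. *)
Lemma polar_rich (u : R * R) (s : seq nat) :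
  uniq s -> (0 < size s)%N ->
  (forall h, h \in s -> (h < N)%N /\ u.1 * C h + u.2 * S h \in V h) ->
  is_line (polar_line (u.1 + w.1, u.2 + w.2)) /\
  (size s <=
    #|` points_on points (polar_line (u.1 + w.1, u.2 + w.2)%R)|)%N.
Proof.
move=> us s0 sP; pose f h := chart h (u.1 * C h + u.2 * S h).
have on h : h \in s -> polar_line (u.1 + w.1, u.2 + w.2) (f h).
  by move=> /sP[hN hV]; apply: chart_on_polar.
split.
  by case: s s0 on {us sP} => // h s _ /(_ h (mem_head _ _)); exact: is_line_polar.
apply: (leq_card_points_on (f := f)) => //.
  by move=> h h' /sP[hN hV] /sP[hN' hV'] /chart_inj[].
move=> h hs; split; last exact: on.
by have [hN hV] := sP h hs; rewrite !inE -in_cons; exact: mem_chart.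
Qed.

Lemma config_lines_rich l : l \in config_lines ->
  is_line l /\ (N - 1 <= #|` points_on points l|)%N.
Proof.
rewrite mem_cat => /orP[/mapP[h]|/mapP[u]].
  rewrite mem_iota add0n /= => hN ->; split; first exact: is_line_axis.
  exact: config_axis_rich.
rewrite mem_rcons in_cons => /orP[/eqP -> ->|/mapP[i]].
  have := @polar_rich (0, 0) (iota 0 N); rewrite /= !add0r -surjective_pairing.
  case=> [||h|lin le].
  - exact: iota_uniq.
  - by rewrite size_iota.
  - rewrite mem_iota add0n => /= hN; rewrite !mul0r addr0; split=> //.
    by rewrite -(height0 R m_gt0 h); apply: heightV; rewrite /N; lia.
  - by split=> //; apply: leq_trans le; rewrite size_iota; lia.
rewrite mem_iota add0n /= => iN -> ->.
(* The side i has no intersection point on the axis j = i modulo N. *)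
pose j := if (i < N)%N then i else (i - N)%N.
have jN : j \in iota 0 N by rewrite mem_iota /j; case: ifP; lia.
have := @polar_rich (C i / inradius R m i, S i / inradius R m i)
  (rem j (iota 0 N)).
have -> : size (rem j (iota 0 N)) = (N - 1)%N.
  by rewrite size_rem // size_iota subn1.
apply.
- by rewrite rem_uniq ?iota_uniq.
- by rewrite /N; lia.
- move=> h; rewrite mem_rem_uniq ?iota_uniq // inE mem_iota add0n /=.
  move=> /andP[hj hN]; split=> //.
  have hi : h != i by move: hj; rewrite /j; case: ifP; lia.
  have hNi : (h + N)%N != i by move: hj; rewrite /j; case: ifP; lia.
  have [d dN e] := tangent_height R m_gt0 iN hN hi hNi.
  by rewrite /= mulrAC [S i / _ * _]mulrAC -mulrDl -e; exact: heightV.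
Qed.

End Configuration.

(** On the axis [0] the condition is [w.1 + v != 0], which is fulfilled by a
suitable [w.1]; on the other axes [sinn h] is nonzero and [w.2] has to avoid
finitely many values. *)
Lemma exists_chart_direction (R : realType) (m : nat) (V : nat -> seq R) :
  (0 < m)%N -> exists w : R * R, forall h v, (h < 12 * m)%N -> v \in V h ->
    w.1 * cosn R (12 * m) h + w.2 * sinn R (12 * m) h + v != 0.
Proof.
move=> m0; have [a aP] := exists_notin [seq - v | v <- V 0].
have [b bP] := exists_notin [seq - (a * cosn R (12 * m) h + v)
  / sinn R (12 * m) h | h <- iota 1 (12 * m - 1), v <- V h].
exists (a, b) => -[|h] v hN vV /=.
  rewrite /cosn /sinn /angle mulr0 mul0r cos0 sin0 mulr0 mulr1 addr0.
  by apply: contraNneq aP => e; apply/mapP; exists v => //; lra.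
have s0 : sinn R (12 * m) h.+1 != 0 by rewrite gt_eqF // sinn_gt0 //; lia.
apply: contraNneq bP => e; apply/allpairsPdep; exists h.+1, v.
split=> //; first by rewrite mem_iota; lia.
by apply: (mulIf s0); rewrite mulfVK //; lra.
Qed.

Local Close Scope ring_scope.
Local Close Scope classical_set_scope.

Theorem mainTheorem5 (R : realType) (n m : nat) (hm : (1 <= m)%N)
    (hn : n = (12 * m - 1)%N) :
  (3 * n + 4 <= T_max R n (n ^ 2))%N /\
  exists (S : {fset R * R}) (L : {fset set (R * R)}),
    [/\ #|` S| = (n ^ 2)%N,
        (3 * n + 4 <= #|` L|)%N
      & forall l : set (R * R),
          l \in L -> is_line l /\ (n <= #|` points_on S l|)%N].
Proof.
have [V VP] := choice (few_heights R hm).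
have [w wP] := exists_chart_direction V hm.
have Vu h : uniq (V h) by case: (VP h).
have Vs h : size (V h) = 12 * m - 2 by case: (VP h).
have Vh h d : 0 < d < 12 * m -> height R m h d \in V h.
  by case: (VP h) => _ _; apply.
pose S := [fset p in config_points m V w]%fset.
pose L := [fset l in config_lines m w]%fset.
have Sn : #|` S| = n ^ 2.
  by rewrite card_fseq undup_id ?size_config_points ?config_points_uniq ?hn.
have Ln : 3 * n + 4 <= #|` L|.
  by rewrite card_fseq undup_id ?size_config_lines ?config_lines_uniq //; lia.
have SL l : l \in L -> is_line l /\ n <= #|` points_on S l|.
  by rewrite in_fset /= hn; exact: (config_lines_rich hm Vu Vs Vh wP).
split; last by exists S, L.
by apply: leq_trans Ln _; apply: rich_lines_leq_T_max Sn SL; lia.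
Qed.
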